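(* Let $x\in\mathcal S$ be a stable g-allocation different from $x^{\max}$, and let $L\in\mathcal L(x)$ be a rotation generated by $x$. Then $x':=x+\chi^{L^+}-\chi^{L^-}$ is a stable g-allocation and $x\prec_F x'$.
   Context: Setting. $G=(V,E)$ is a finite connected bipartite graph without multiple edges, $V$ partitioned into independent sets $W$ (workers) and $F$ (firms). $E_v$ is the set of edges incident to $v$; $wf$ denotes the edge joining $w\in W$, $f\in F$. There are capacities $b:E\to\mathbb Z_+$ and quotas $q:W\to\mathbb Z_+$. $\mathcal B=\{x\in\mathbb Z_+^E: x\le b\}$; $\mathcal B_v$ is the set of restrictions of members of $\mathcal B$ to $E_v$; $x_v$ is the restriction of $x$ to $E_v$. For $z\ge 0$, $|z|=\sum_e z(e)$. $\wedge,\vee$ are coordinatewise min and max; $\mathbf 1^e$ is the unit vector of $e$; $\mathrm{supp}(z)=\{e: z(e)\neq 0\}$. Choice functions $C_v:\mathcal B_v\to\mathcal B_v$. Each $w\in W$ has a strict linear order $>_w$ on $E_w$ ($e>_w e'$: $e$ is preferred to $e'$), and $C_w(z)=z$ if $|z|\le q(w)$; if $|z|>q(w)$, number $E_w$ as $e_1>_we_2>_w\cdots$, take the maximal $j$ with $r:=\sum_{i\le j}z(e_i)\le q(w)$ and let $C_w(z)=(z(e_1),\ldots,z(e_j),q(w)-r,0,\ldots,0)$. Each $f\in F$ has a $C_f$ with $C_f(z)\le z$ such that for all $z\ge z'$ in $\mathcal B_f$: (A1) $z'\ge C_f(z)$ implies $C_f(z')=C_f(z)$; (A2) $C_f(z)\wedge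 z'\le C_f(z')$; (A3) $|C_f(z)|\ge|C_f(z')|$. $\mathcal A_v=\{z\in\mathcal B_v: C_v(z)=z\}$ (acceptable). For distinct $z,z'\in\mathcal A_v$: $z'\prec_v z$ iff $C_v(z\vee z')=z$. A g-allocation is $x\in\mathcal B$ with $x_v\in\mathcal A_v$ for all $v\in V$. For distinct g-allocations, $x\prec_F y$ iff $x_f\preceq_f y_f$ for all $f\in F$. For $z\in\mathcal A_v$, $e\in E_v$ is interesting for $v$ under $z$ if there is $z'\in\mathcal B_v$ with $z'(e)>z(e)$, $z'(e')=z(e')$ for $e'\ne e$, and $C_v(z')(e)>z(e)$; ''interesting for $v$ under $x$'' means under $x_v$. An edge $wf$ blocks $x$ if it is interesting under $x$ for both $w$ and $f$. A g-allocation is stable if no edge blocks it; $\mathcal S$ is the set of stable g-allocations. It is known that $(\mathcal S,\prec_F)$ is a nonempty distributive lattice; $x^{\min},x^{\max}$ are its minimal and maximal elements. Rotations. Let $x\in\mathcal S$ and $W^==\{w\in W:|x_w|=q(w)\}$. For $w\in W^=$ let $\ell_w(x)$ be the least preferred edge (under $>_w$) of $\mathrm{supp}(x_w)$. The most preferred edge (if any) among the edges $e=wf\in E_w$ with $e\le_w\ell_w(x)$ and $e$ interesting for $f$ under $x$ is called $W$-admissible and denoted $a_w(x)$ (there is none if $x_w=0$). For a $W$-admissible $a=wf$, $C_f(x_f+\mathbf 1^a)$ equals $x_f+\mathbf 1^a$ or $x_f+\mathbf 1^a-\mathbf 1^c$ for some $c\in E_f\setminus\{a\}$; in the latter case $c$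 is called $F$-admissible, associated with $a$, and $(a,c)$ is a tandem for $x$ passing $f$. $D(x)$ is the directed graph on $V$ whose edges are the $W$-admissible edges directed from $W$ to $F$ and the $F$-admissible edges directed from $F$ to $W$. Cleaning: while some $w\in W$ has a leaving edge $a=(w,f)$ but no entering edge, delete $a$, and also delete the edge $c$ associated with $a$ (if exists) when $c$ is in no other tandem passing $f$ in the current graph; remove isolated vertices. The final graph is the active graph $\Gamma(x)$. In it each vertex of $W$ has exactly one entering and one leaving edge, and at each vertex $f\in F$ the tandems passing $f$ are edge-disjoint and partition the edges of $\Gamma(x)$ at $f$. Hence $\Gamma(x)$ decomposes uniquely into edge-disjoint directed edge-simple cycles in which consecutive edges at each $f\in F$ form a tandem; these cycles are the rotations generated by (applicable to) $x$, and $\mathcal L(x)$ is their set. For a rotation $L$, $L^+$ (resp. $L^-$) is the set of its edges directed from $W$ to $F$ (resp. from $F$ to $W$), identified with the underlying edges of $G$. $\chi^A\in\mathbb R^E$ is the 0/1 incidence vector of $A\subseteq E$. *)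

(* Defs.v *)
From HB Require Import structures.
From mathcomp Require Import all_boot all_order all_algebra.
From mathcomp Require Import boolp.

Set Implicit Arguments.
Unset Strict Implicit.
Unset Printing Implicit Defensive.

Import GRing.Theory.

(* Vectors on an edge set [E_v] are represented by their extension by 0 to   *)
(* the whole of [E].                                                         *)
Notation vec E := {ffun E -> nat}.

Section Vectors.
Context {E : finType}.
Implicit Types (z : vec E) (A : {set E}).

Definition vsize z : nat := \sum_e z e.
Definition vle z z' : bool := [forall e, z e <= z' e].
Definition vmeet z z' : vec E := [ffun e => minn (z e) (z' e)].
Definition vjoin z z' : vec E := [ffun e => maxn (z e) (z' e)].

(* The incidence vector of A; the unit vector of e is [chi [set e]]. *)
Definition chi A : vec E := [ffun e => (e \in A : nat)].

Definition vecZ z : {ffun E -> int} := [ffun e => Posz (z e)].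

End Vectors.

Record market (W F E : finType) := Market {
  wend : E -> W;
  fend : E -> F;
  cap : E -> nat;
  quota : W -> nat;
  (* [pref w e e'] means e >_w e', that is, w prefers e to e'; only its
     restriction to the edges at w matters. *)
  pref : W -> rel E;
  (* Only the values of [CF f] on [inBv (inr f)] (below) matter. *)
  CF : F -> vec E -> vec E
}.

Section Market.
Context {W F E : finType} (M : market W F E).
Implicit Types (v : W + F) (w : W) (f : F) (e a c l : E) (x y z : vec E).

Definition edges_at v : {set E} :=
  match v with
  | inl w => [set e | wend M e == w]
  | inr f => [set e | fend M e == f]
  end.

Definition adjacent : rel (W + F) :=
  fun u v => (u != v) && [exists e, (e \in edges_at u) && (e \in edges_at v)].

Definition inB x : Prop := forall e, x e <= cap M e.

Definition restr v x : vec E := [ffun e => if e \in edges_at v then x e else 0].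

Definition inBv v z : Prop := exists2 x, inB x & z = restr v x.

Definition prefs_seq w : seq E :=
  sort (fun e e' => (e == e') || pref M w e e') (enum (edges_at (inl w))).

Definition CW w z : vec E :=
  if vsize z <= quota M w then z else
  let s := prefs_seq w in
  let head j := \sum_(e <- take j s) z e in
  let j := \max_(i < (size s).+1 | head i <= quota M w) i in
  [ffun e => if index e s < j then z e
             else if index e s == j then quota M w - head j else 0].

Definition choice v : vec E -> vec E :=
  match v with inl w => CW w | inr f => CF M f end.

Record valid_market : Prop := ValidMarket {
  no_multiple_edges : injective (fun e => (wend M e, fend M e));
  graph_connected : forall u v : W + F, connect adjacent u v;
  pref_irr : forall w, {in edges_at (inl w), forall e, ~~ pref M w e e};
  pref_trans : forall w, {in edges_at (inl w) & &, transitive (pref M w)};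
  pref_total : forall w, {in edges_at (inl w) &,
    forall e e', e != e' -> pref M w e e' || pref M w e' e};
  CF_le : forall f z, inBv (inr f) z -> vle (CF M f z) z;
  CF_consistent : forall f z z', inBv (inr f) z -> inBv (inr f) z' ->
    vle z' z -> vle (CF M f z) z' -> CF M f z' = CF M f z;
  CF_substitutable : forall f z z', inBv (inr f) z -> inBv (inr f) z' ->
    vle z' z -> vle (vmeet (CF M f z) z') (CF M f z');
  CF_size_monotone : forall f z z', inBv (inr f) z -> inBv (inr f) z' ->
    vle z' z -> vsize (CF M f z') <= vsize (CF M f z)
}.

Definition acceptable v z : Prop := inBv v z /\ choice v z = z.

Definition prec_at v z' z : Prop :=
  [/\ acceptable v z', acceptable v z, z' <> z & choice v (vjoin z z') = z].

Definition preceq_at v z' z : Prop :=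
  (acceptable v z /\ z' = z) \/ prec_at v z' z.

Definition g_allocation x : Prop :=
  inB x /\ forall v, acceptable v (restr v x).

Definition precF x y : Prop :=
  [/\ g_allocation x, g_allocation y, x <> y &
      forall f, preceq_at (inr f) (restr (inr f) x) (restr (inr f) y)].

Definition interesting v z e : Prop :=
  e \in edges_at v /\
  exists z', [/\ inBv v z', z e < z' e, forall e', e' != e -> z' e' = z e' &
                 z e < choice v z' e].

Definition interesting_under v x e : Prop := interesting v (restr v x) e.

Definition blocks x e : Prop :=
  interesting_under (inl (wend M e)) x e /\
  interesting_under (inr (fend M e)) x e.

Definition stable x : Prop := g_allocation x /\ forall e, ~ blocks x e.

Definition is_xmax x : Prop :=
  stable x /\ forall y, stable y -> y = x \/ precF y x.

Definition fully_filled x w : Prop := vsize (restr (inl w) x) = quota M w.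

Definition least_preferred x w l : Prop :=
  [/\ l \in edges_at (inl w), x l != 0 &
      forall e, e \in edges_at (inl w) -> x e != 0 -> e = l \/ pref M w e l].

Definition W_candidate x w l e : Prop :=
  [/\ e \in edges_at (inl w), e = l \/ pref M w l e &
      interesting_under (inr (fend M e)) x e].

Definition W_admissible x a : Prop :=
  let w := wend M a in
  fully_filled x w /\
  exists l, [/\ least_preferred x w l, W_candidate x w l a &
    forall e, W_candidate x w l e -> e = a \/ pref M w a e].

(* The subtraction in C_f(x_f + 1^a) = x_f + 1^a - 1^c is moved to the other *)
(* side, since vectors are over nat.                                         *)
Definition tandem x a c : Prop :=
  let f := fend M a in
  let xa := (restr (inr f) x + chi [set a])%R in
  [/\ W_admissible x a, c \in edges_at (inr f), c != a &
      (CF M f xa + chi [set c])%R = xa].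

Definition F_admissible x c : Prop := exists a, tandem x a c.

(* A directed graph without isolated vertices: the edges directed from W to  *)
(* F, and the edges directed from F to W.                                    *)
Definition digraph : Type := ({set E} * {set E})%type.

Definition Dgraph x : digraph :=
  ([set a | `[< W_admissible x a >]], [set c | `[< F_admissible x c >]]).

Definition clean_step x (G G' : digraph) : Prop :=
  exists a, [/\ a \in G.1,
    forall c, c \in G.2 -> wend M c <> wend M a,
    G'.1 = G.1 :\ a &
    forall c, c \in G'.2 <->
      c \in G.2 /\
      ~ (tandem x a c /\
         forall a', a' \in G.1 -> tandem x a' c -> a' = a)].

Inductive clean_steps x (G : digraph) : digraph -> Prop :=
| clean_refl : clean_steps x G G
| clean_trans G' G'' :
    clean_steps x G G' -> clean_step x G' G'' -> clean_steps x G G''.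

Definition active_graph x (G : digraph) : Prop :=
  clean_steps x (Dgraph x) G /\ forall G', ~ clean_step x G G'.

(* A rotation is a cyclic sequence of tandems (a_i, c_i), where a_i goes     *)
(* from w_i to f_i and c_i from f_i to w_{i+1}.  An edge of the directed     *)
(* graph is repeated iff some a_i or some c_i is.                            *)
Definition rotation x (L : seq (E * E)) : Prop :=
  exists2 G, active_graph x G &
    [/\ L <> [::],
        forall p, p \in L -> [/\ p.1 \in G.1, p.2 \in G.2 & tandem x p.1 p.2],
        cycle (fun p p' => wend M p.2 == wend M p'.1) L,
        uniq (map fst L) & uniq (map snd L)].

End Market.

Definition Lplus {E : finType} (L : seq (E * E)) : {set E} :=
  [set e in map fst L].
Definition Lminus {E : finType} (L : seq (E * E)) : {set E} :=
  [set e in map snd L].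

(* Main.v *)
Require Import Defs.
From mathcomp Require Import all_boot all_order all_algebra.
From mathcomp Require Import zify.

Set Implicit Arguments.
Unset Strict Implicit.
Unset Printing Implicit Defensive.

(** Let [Z_v] denote the restriction of a vector or set [Z] to the edges at
    [v], and put [x' = x + chi L+ - chi L-].  Following the cycle [L], one
    leaves each vertex as often as one enters it, so [L+] and [L-] have equally
    many edges at every vertex and [|x'_v| = |x_v|] for all [v]
    ([rotation_balanced], [vsize_shift]).

    Acceptability and [x] below [x'].  At a worker met by [L] the size of [x_w]
    is the quota, hence so is that of [x'_w], which is therefore acceptable.
    At a firm [f], let [t = x_f + chi L+_f].  Each [c] in [L-_f] is rejected by
    [f] once its associated edge alone is added to [x_f]; by substitutability
    it is still rejected from [t], and size monotonicity forbids [f] to reject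
    more than these edges.  So [C_f(t) = x'_f]
    ([CF_simultaneous_exchange], [CF_shift]).  This needs [L+] and [L-] to be
    disjoint, which holds because an edge of [L-], being rejected when another
    edge is increased, is not interesting for its firm, whereas every edge of
    [L+] is ([CF_rejected_not_interesting], [Lplus_Lminus_disjoint]).  Then
    [t] is the join of [x_f] and [x'_f], and [C_f(t) = x'_f] says that [f]
    prefers [x'_f]; consistency makes [x'_f] acceptable.

    Stability.  As firms become better off, fewer edges interest them
    ([interesting_firm_antimono]); so an edge [e = wf] that blocks [x'] is
    interesting for [f] under [x], and by stability of [x] it is not
    interesting for [w] under [x].  Thus [L] passes [w] and [e] is not
    preferred to the worst edge used by [x_w].  This makes [e] a candidate in
    the choice of the [W]-admissible edge [a] at [w], so [w] weakly prefers [a]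
    to [e].  Every edge used by [x'_w] is [a] or is used by [x_w], so [e] is
    preferred to none of them; since [w] is filled, [e] does not interest [w]
    under [x'] ([interesting_workerP]), a contradiction ([shift_stable]). *)

(** * Vectors *)

Section Vectors.
Context {E : finType}.
Implicit Types (u v z : vec E) (A : {set E}).

Lemma vaddE u v e : (u + v)%R e = u e + v e.
Proof. by rewrite ffunE. Qed.

Lemma chiE A e : chi A e = (e \in A).
Proof. by rewrite ffunE. Qed.

Lemma vmeetE u v e : vmeet u v e = minn (u e) (v e).
Proof. by rewrite ffunE. Qed.

Lemma vjoinE u v e : vjoin u v e = maxn (u e) (v e).
Proof. by rewrite ffunE. Qed.

Lemma vsizeD u v : vsize (u + v)%R = vsize u + vsize v.
Proof.
rewrite /vsize -[RHS]big_split /=; apply: eq_bigr => e _; exact: vaddE.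
Qed.

Lemma vsize_chi A : vsize (chi A) = #|A|.
Proof.
rewrite /vsize -sum1_card [RHS]big_mkcond /=; apply: eq_bigr => e _.
by rewrite chiE; case: (e \in A).
Qed.

Lemma vle_vsize_eq u v : vle u v -> vsize v <= vsize u -> u = v.
Proof.
move=> /forallP le_uv le_size; apply/ffunP => e; apply/eqP.
rewrite eqn_leq le_uv /= leqNgt; apply/negP => lt_e.
move: le_size; rewrite leqNgt /vsize (bigD1 e) //= [ltnRHS](bigD1 e) //=.
by rewrite -addSn leq_add // leq_sum.
Qed.

End Vectors.

Section Market.
Context {W F E : finType} (M : market W F E).
Hypothesis hM : valid_market M.
Implicit Types (v : W + F) (w : W) (f : F) (e a c l : E) (x y z : vec E).

Lemma inBvP v z : inBv M v z <->
  (forall e, z e <= cap M e) /\ (forall e, e \notin edges_at M v -> z e = 0).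
Proof.
split=> [[x xB ->]|[zB z0]].
  split=> e; rewrite ffunE; first by case: ifP.
  by move=> /negbTE ->.
exists z => //; apply/ffunP => e; rewrite ffunE.
by case: ifPn => // /z0.
Qed.

Lemma restrE v x e : e \in edges_at M v -> restr M v x e = x e.
Proof. by rewrite ffunE => ->. Qed.

Lemma restr_inBv v x : inB M x -> inBv M v (restr M v x).
Proof. by move=> xB; exists x. Qed.

Lemma at_fend e : e \in edges_at M (inr (fend M e)).
Proof. by rewrite inE. Qed.

Lemma at_wend e : e \in edges_at M (inl (wend M e)).
Proof. by rewrite inE. Qed.

(** * Firms *)

Lemma inBv_add_chi v z (A : {set E}) : inBv M v z -> A \subset edges_at M v ->
  (forall a, a \in A -> z a < cap M a) -> inBv M v (z + chi A)%R.
Proof.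
move=> /inBvP [zB z0] /subsetP sA capA; apply/inBvP; split=> e.
  rewrite vaddE chiE; case: (boolP (e \in A)) => [/capA|_].
    by rewrite addn1.
  by rewrite addn0.
move=> eNv; rewrite vaddE chiE z0 // (negbTE (contra (sA e) eNv)).
by [].
Qed.

Lemma inBv_add1 v z e : inBv M v z -> e \in edges_at M v -> z e < cap M e ->
  inBv M v (z + chi [set e])%R.
Proof.
move=> zB ev lt_e; apply: inBv_add_chi => //; first by rewrite sub1set.
by move=> a; rewrite inE => /eqP ->.
Qed.

Lemma vle_addr z z' : vle z (z + z')%R.
Proof. by apply/forallP => e; rewrite vaddE leq_addr. Qed.

Lemma inBv_join v z z' : inBv M v z -> inBv M v z' -> inBv M v (vjoin z z').
Proof.
move=> /inBvP [zc z0] /inBvP [zc' z0']; apply/inBvP; split=> d; rewrite vjoinE.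
  by rewrite geq_max zc zc'.
by move=> dN; rewrite z0 // z0'.
Qed.

(** By substitutability, if some increase of [z e] is partly kept then so is
    the unit increase, so only the latter has to be tested. *)
Lemma interesting_firmP f z e : inBv M (inr f) z ->
  interesting M (inr f) z e <->
  [/\ e \in edges_at M (inr f), z e < cap M e &
      z e < CF M f (z + chi [set e])%R e].
Proof.
move=> zB; split=> [[ef [z' [z'B lt_z' eq_z' gt_C]]]|[ef lt_cap gt_C]].
  have lt_cap : z e < cap M e.
    by have [le_cap _] := (inBvP _ _).1 z'B; apply: leq_trans (le_cap e).
  split=> //.
  have z1B := inBv_add1 zB ef lt_cap.
  have le1 : vle (z + chi [set e])%R z'.
    apply/forallP => d; rewrite vaddE chiE inE.
    by have [->|/eq_z' ->] := eqVneq d e; rewrite ?addn1 ?addn0.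
  have /forallP/(_ e) := CF_substitutable hM z'B z1B le1.
  rewrite vmeetE vaddE chiE set11 /=.
  by move: gt_C => /=; lia.
split=> //; exists (z + chi [set e])%R; split=> //.
- exact: inBv_add1.
- by rewrite vaddE chiE set11 addn1.
- by move=> d ne_d; rewrite vaddE chiE inE (negbTE ne_d) addn0.
Qed.

(** Increase both [a] and [c].  By substitutability the outcome takes no
    more of [c] than the choice from [z + 1^a] does, so by consistency it is
    that choice, [z + 1^a - 1^c].  Substitutability then gives
    [z <= C_f(z + 1^c)], and size monotonicity gives [|C_f(z + 1^c)| <= |z|]:
    the unit added on [c] is rejected. *)
Lemma CF_rejected_not_interesting f z a c : inBv M (inr f) z ->
  a \in edges_at M (inr f) -> z a < cap M a -> c != a ->
  (CF M f (z + chi [set a]) + chi [set c])%R = (z + chi [set a])%R ->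
  ~ interesting M (inr f) z c.
Proof.
move=> zB af lt_a ne_ca eqC /(interesting_firmP _ zB) [cf lt_c gt_C].
pose za := (z + chi [set a])%R; pose zc := (z + chi [set c])%R.
pose zac := (za + chi [set c])%R.
have zaB : inBv M (inr f) za by exact: inBv_add1.
have zcB : inBv M (inr f) zc by exact: inBv_add1.
have zacB : inBv M (inr f) zac.
  apply: inBv_add1 => //.
  by rewrite vaddE chiE inE (negbTE ne_ca) addn0.
have le_za : vle za zac by exact: vle_addr.
have le_zc : vle zc zac.
  by apply/forallP => e; rewrite !vaddE; lia.
have eqCe e : CF M f za e + (e == c) = z e + (e == a).
  have := congr1 (fun u : vec E => u e) eqC.
  by rewrite /= !vaddE !chiE !inE.
have Cac : CF M f zac = CF M f za.
  symmetry; apply: (CF_consistent hM zacB zaB le_za).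
  apply/forallP => e.
  have /forallP/(_ e) := CF_le hM zacB.
  have /forallP/(_ e) := CF_substitutable hM zacB zaB le_za.
  move: (eqCe e); rewrite !vmeetE !vaddE !chiE !inE.
  by have [->|ne_e] := eqVneq e c; rewrite ?(negbTE ne_ca) /=; lia.
have le_size : vsize (CF M f zc) <= vsize z.
  have := CF_size_monotone hM zacB zcB le_zc; rewrite Cac.
  have := congr1 vsize eqC; rewrite !vsizeD !vsize_chi !cards1.
  by rewrite -/za; lia.
have eq_zC : z = CF M f zc.
  apply: vle_vsize_eq => //; apply/forallP => e.
  have /forallP/(_ e) := CF_substitutable hM zacB zcB le_zc.
  move: (eqCe e) gt_C; rewrite Cac vmeetE !vaddE !chiE !inE -/zc.
  by have [->|ne_e] := eqVneq e c; rewrite ?(negbTE ne_ca) /=; lia.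
by move: gt_C; rewrite -/zc -eq_zC ltnn.
Qed.

(** Substitutability carries each individual rejection over to the choice from
    [z + chi A], which therefore lies below [y]; size monotonicity, with
    [|y| = |z|], leaves no room for further rejections. *)
Lemma CF_simultaneous_exchange f z y (A B : {set E}) : inBv M (inr f) z ->
  CF M f z = z -> A \subset edges_at M (inr f) ->
  (forall a, a \in A -> z a < cap M a) ->
  (forall c, c \in B -> exists2 a, a \in A &
     CF M f (z + chi [set a])%R c < z c) ->
  [disjoint A & B] -> #|A| = #|B| -> (y + chi B = z + chi A)%R ->
  CF M f (z + chi A)%R = y.
Proof.
move=> zB Cz sA capA rejB disAB cardAB eq_y.
have zAB := inBv_add_chi zB sA capA.
apply: vle_vsize_eq; last first.
  have := CF_size_monotone hM zAB zB (vle_addr _ _); rewrite Cz.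
  have := congr1 vsize eq_y; rewrite !vsizeD !vsize_chi cardAB.
  by lia.
apply/forallP => e; have /forallP/(_ e) := CF_le hM zAB.
have := congr1 (fun u : vec E => u e) eq_y; rewrite /= !vaddE !chiE.
have [eB|_] := boolP (e \in B); last by rewrite addn0 => ->.
have [a aA lt_C] := rejB e eB.
have zaB : inBv M (inr f) (z + chi [set a])%R.
  by apply: inBv_add1 => //; [exact: (subsetP sA)|exact: capA].
have le_za : vle (z + chi [set a])%R (z + chi A)%R.
  apply/forallP => d; rewrite !vaddE !chiE inE.
  by have [->|_] := eqVneq d a; rewrite ?aA ?addn0 ?leq_addr.
have /forallP/(_ e) := CF_substitutable hM zAB zaB le_za.
rewrite vmeetE !vaddE !chiE.
by rewrite (disjointFl disAB eB) /=; lia.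
Qed.

(** The better a firm is served, the fewer edges interest it.  The join [t] of
    [y] and [z] is compared with [y + 1^e] and with [t + 1^e]: if [t] gave [e]
    more than [y] does, or if the new unit of [e] were rejected from [t + 1^e],
    then consistency would make [y] the choice from [y + 1^e].  So the unit is
    kept in [t + 1^e], and by substitutability also in [z + 1^e]. *)
Lemma interesting_firm_antimono f z y e : inBv M (inr f) z ->
  inBv M (inr f) y -> CF M f (vjoin y z) = y ->
  interesting M (inr f) y e -> interesting M (inr f) z e.
Proof.
move=> zB yB; set t := vjoin y z => Ct.
move=> /(interesting_firmP _ yB) [ef lt_cap gt_C].
apply/(interesting_firmP _ zB).
have tE d : t d = maxn (y d) (z d) by rewrite vjoinE.
have tB : inBv M (inr f) t by exact: inBv_join.
have y1B := inBv_add1 yB ef lt_cap.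
pose y1 := (y + chi [set e])%R; rewrite -/y1 in y1B gt_C.
have y1E d : y1 d = y d + (d == e) by rewrite vaddE chiE inE.
have [lt_yz|le_zy] := ltnP (y e) (z e).
  have le_y1 : vle y1 t.
    apply/forallP => d; rewrite y1E tE.
    by have [->|_] := eqVneq d e; lia.
  have Cy1 : CF M f y1 = y.
    rewrite (CF_consistent hM tB y1B le_y1) // Ct.
    by apply/forallP => d; rewrite y1E leq_addr.
  by move: gt_C; rewrite Cy1 ltnn.
pose t1 := (t + chi [set e])%R.
have t1E d : t1 d = t d + (d == e) by rewrite vaddE chiE inE.
have te : t e = y e by rewrite tE; apply/maxn_idPl.
have t1B : inBv M (inr f) t1 by apply: inBv_add1; rewrite ?te.
have lt_C1 : y e < CF M f t1 e.
  rewrite ltnNge; apply/negP => le_C1.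
  have le_Ct : vle (CF M f t1) t.
    apply/forallP => d; have /forallP/(_ d) := CF_le hM t1B.
    rewrite t1E; have [->|_] := eqVneq d e; first by rewrite te.
    by rewrite addn0.
  have Ct1 : CF M f t1 = y.
    by rewrite -(CF_consistent hM t1B tB (vle_addr _ _) le_Ct).
  by move: le_C1 le_Ct gt_C; rewrite (CF_consistent hM t1B y1B) ?Ct1 ?ltnn //;
    apply/forallP => d; rewrite ?t1E ?y1E ?tE ?leq_addr ?leq_add2r ?leq_maxl.
have lt_ze : z e < cap M e by apply: leq_ltn_trans le_zy _.
split=> //; have z1B := inBv_add1 zB ef lt_ze.
have le_z1 : vle (z + chi [set e])%R t1.
  by apply/forallP => d; rewrite vaddE chiE inE t1E tE; lia.
have /forallP/(_ e) := CF_substitutable hM t1B z1B le_z1.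
by rewrite vmeetE vaddE chiE set11; lia.
Qed.

(** * Workers *)

Section Worker.
Variable w : W.
Let s := prefs_seq M w.
Let head z j := \sum_(e <- take j s) z e.

Lemma mem_prefs e : (e \in s) = (e \in edges_at M (inl w)).
Proof. by rewrite mem_sort mem_enum. Qed.

Lemma uniq_prefs : uniq s.
Proof. by rewrite sort_uniq enum_uniq. Qed.

Lemma index_prefs e e' : e \in edges_at M (inl w) ->
  e' \in edges_at M (inl w) -> (index e s < index e' s) = pref M w e e'.
Proof.
move=> ew e'w; pose r e e' := (e == e') || pref M w e e'.
have r_sorted : sorted r s.
  apply: (@sort_sorted_in _ (mem (edges_at M (inl w)))) => [d d' dw d'w|].
    rewrite /r; have [//|ne /=] := eqVneq d d'.
    by case/orP: (pref_total hM dw d'w ne) => ->; rewrite ?orbT.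
  by apply/allP => d; rewrite mem_enum.
have r_trans : {in edges_at M (inl w) & &, transitive r}.
  move=> d' d d'' d'w dw d''w; rewrite /r.
  have [-> //|_] := eqVneq d d'.
  have [<-|_] := eqVneq d' d''; first by move=> /= ->; rewrite orbT.
  by move=> /= p1 p2; rewrite (pref_trans hM d'w dw d''w p1 p2) orbT.
have lt_pref d d' : d \in edges_at M (inl w) -> d' \in edges_at M (inl w) ->
    index d s < index d' s -> pref M w d d'.
  move=> dw d'w lt_i.
  have : r d d'.
    apply: (sorted_ltn_index_in (s := s)) => //.
    - by move=> a b c; rewrite !mem_prefs; apply: r_trans.
    - by rewrite mem_prefs.
    - by rewrite mem_prefs.
  by case/orP => // /eqP eq_d; rewrite eq_d ltnn in lt_i.
apply/idP/idP; first exact: lt_pref.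
move=> p; rewrite ltnNge leq_eqVlt; apply/negP => /orP [/eqP eq_i|lt_i].
  have eq_e : e' = e.
    by rewrite -(nth_index e (_ : e' \in s)) ?mem_prefs // eq_i
      nth_index ?mem_prefs.
  by rewrite eq_e (negbTE (pref_irr hM ew)) in p.
have := pref_irr hM ew.
by rewrite (pref_trans hM e'w ew ew p (lt_pref _ _ e'w ew lt_i)).
Qed.

Lemma headE z j : head z j = \sum_(e in edges_at M (inl w) | index e s < j) z e.
Proof.
rewrite /head big_uniq ?take_uniq ?uniq_prefs //; apply: eq_bigl => e.
rewrite -mem_prefs; have [es|eNs] := boolP (e \in s); last first.
  by apply: contraNF eNs; apply: mem_take.
by rewrite in_take.
Qed.

Lemma head_mono z i j : i <= j -> head z i <= head z j.
Proof.
move=> le_ij; rewrite !headE big_mkcond [leqRHS]big_mkcond leq_sum // => e _.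
case: (e \in _) => //=; have [lt_i|//] := ltnP; first last.
by rewrite (leq_trans lt_i).
Qed.

Lemma headS z e : e \in edges_at M (inl w) ->
  head z (index e s).+1 = z e + head z (index e s).
Proof.
move=> ew; rewrite !headE (bigD1 e) /= ?ew ?leqnn //; congr (_ + _).
apply: eq_bigl => d; rewrite -andbA; have [dw|//] := boolP (d \in _).
rewrite /= ltnS [RHS]ltn_neqAle andbC; congr (~~ _ && _).
apply/eqP/eqP => [-> //|eq_i].
by rewrite -(nth_index e (_ : d \in s)) ?mem_prefs // eq_i nth_index ?mem_prefs.
Qed.

Lemma head_vsize z j : inBv M (inl w) z ->
  (forall d, d \in edges_at M (inl w) -> j <= index d s -> z d = 0) ->
  head z j = vsize z.
Proof.
move=> /inBvP [_ z0] zj; rewrite headE big_mkcond; apply: eq_bigr => d _.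
have [dw|/z0 -> //] := boolP (d \in edges_at M (inl w)).
by have [//|le_j] := ltnP; rewrite zj.
Qed.

Lemma head_add_le z j d : d \in edges_at M (inl w) -> j <= index d s ->
  head z j + z d <= vsize z.
Proof.
move=> dw le_j; rewrite headE /vsize [leqRHS](bigD1 d) //= addnC leq_add2l.
rewrite big_mkcond [leqRHS]big_mkcond leq_sum // => c _.
have [->|_] := eqVneq c d; first by rewrite ltnNge le_j andbF.
by case: ifP.
Qed.

(* The number of most preferred edges whose total fits into the quota: the
   choice of w keeps these entirely and at most part of the next one. *)
Let cut z := \max_(i < (size s).+1 | head z i <= quota M w) i.

Lemma CW_overfull z e : quota M w < vsize z ->
  CW M w z e = if index e s < cut z then z e
               else if index e s == cut z then quota M w - head z (cut z)
               else 0.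
Proof. by move=> gt_z; rewrite /CW leqNgt gt_z /= ffunE. Qed.

Lemma head_cut z : head z (cut z) <= quota M w.
Proof.
have h0 : head z (@ord0 (size s)) <= quota M w by rewrite /head take0 big_nil.
rewrite /cut (bigmax_eq_arg ord0 h0).
by case: arg_maxnP.
Qed.

Lemma leq_cut z j : j <= size s -> head z j <= quota M w -> j <= cut z.
Proof.
rewrite -ltnS => lt_j le_q.
exact: (leq_bigmax_cond (F := fun i : 'I_(size s).+1 => val i) (Ordinal lt_j)).
Qed.

(** A worker exactly at the quota accepts more of [e] only by giving up a less
    preferred edge in use. If there is one, the unit added on [e] stays within
    the first [cut] edges; if there is none, the edges up to [e] already
    overfill the quota, and at most the old amount of [e] is kept. *)
Lemma interesting_workerP z e : inBv M (inl w) z -> vsize z = quota M w ->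
  interesting M (inl w) z e <->
  [/\ e \in edges_at M (inl w), z e < cap M e &
      exists d, [/\ d \in edges_at M (inl w), z d != 0 & pref M w e d]].
Proof.
move=> zB size_z; split=> [[ew [z' [z'B lt_z' eq_z' gt_C]]]|].
  have [le_cap z'0] := (inBvP _ _).1 z'B.
  split=> //; first exact: leq_trans (le_cap e).
  suff /existsP[d /and3P[]] : [exists d, [&& d \in edges_at M (inl w),
    z d != 0 & pref M w e d]] by exists d.
  apply: contraLR gt_C => /existsPn noD; rewrite -leqNgt /choice.
  have size_z' : vsize z' + z e = quota M w + z' e.
    rewrite -size_z /vsize (bigD1 e) //= [in RHS](bigD1 e) //=.
    by rewrite (eq_bigr (fun d => z d) eq_z') addnAC [z' e + z e]addnC addnAC.
  have gt_size : quota M w < vsize z' by move: lt_z' size_z'; lia.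
  have head_all : head z' (index e s).+1 = vsize z'.
    apply: head_vsize => // d dw lt_d.
    have ne_d : d != e by apply: contraL lt_d => /eqP ->; rewrite -leqNgt.
    have := noD d; rewrite dw -index_prefs // lt_d andbT /= negbK.
    by rewrite eq_z' // => /eqP.
  rewrite CW_overfull //; have [lt_j|le_j] := ltnP.
    have := leq_trans (head_mono z' lt_j) (head_cut z').
    by rewrite head_all leqNgt gt_size.
  case: eqP => // <-; move: head_all; rewrite headS //.
  by move: size_z'; lia.
case=> ew lt_cap [d [dw z_d p_ed]]; split=> //.
exists (z + chi [set e])%R; split=> //.
- exact: inBv_add1.
- by rewrite vaddE chiE set11 addn1.
- by move=> c ne_c; rewrite vaddE chiE inE (negbTE ne_c) addn0.
set z1 := (z + _)%R; have size_z1 : vsize z1 = (quota M w).+1.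
  by rewrite vsizeD vsize_chi cards1 size_z addn1.
have lt_i : index e s < index d s by rewrite index_prefs.
rewrite /= CW_overfull ?size_z1 // leq_cut.
- by rewrite vaddE chiE set11 addn1.
- by rewrite index_mem mem_prefs.
have := head_add_le z1 dw lt_i; rewrite size_z1 vaddE.
by move: z_d; rewrite -lt0n; lia.
Qed.

End Worker.

(** * Rotations *)

Section Shift.
Variables (x : vec E) (L : seq (E * E)) (x' : vec E).
Hypotheses (hx : stable M x)
  (tandemL : forall p, p \in L -> tandem M x p.1 p.2)
  (cycleL : cycle (fun p p' => wend M p.2 == wend M p'.1) L)
  (uniqLp : uniq (map fst L)) (uniqLm : uniq (map snd L))
  (x'E : forall e, x' e + (e \in Lminus L) = x e + (e \in Lplus L)).

Let xB v : inBv M v (restr M v x).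
Proof. by apply: restr_inBv; case: hx => -[]. Qed.

Lemma LplusP a : a \in Lplus L -> exists c, (a, c) \in L.
Proof. by rewrite inE => /mapP [[a' c] pL /= ->]; exists c. Qed.

Lemma LminusP c : c \in Lminus L -> exists a, (a, c) \in L.
Proof. by rewrite inE => /mapP [[a c'] pL /= ->]; exists a. Qed.

Lemma W_admissible_interesting a : W_admissible M x a ->
  interesting_under M (inr (fend M a)) x a.
Proof. by case=> _ [l [_ []]]. Qed.

Lemma W_admissible_cap a : W_admissible M x a -> x a < cap M a.
Proof.
move=> /W_admissible_interesting /(interesting_firmP _ (xB _)) [af lt_a _].
by rewrite restrE in lt_a.
Qed.

Lemma Lplus_admissible a : a \in Lplus L -> W_admissible M x a.
Proof. by move=> /LplusP [c /tandemL []]. Qed.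

Lemma tandem_fend p : p \in L -> fend M p.1 = fend M p.2.
Proof. by move=> /tandemL [_]; rewrite inE => /eqP. Qed.

Lemma Lminus_rejected c : c \in Lminus L ->
  exists2 a, a \in Lplus L :&: edges_at M (inr (fend M c)) &
    CF M (fend M c) (restr M (inr (fend M c)) x + chi [set a])%R c < x c.
Proof.
move=> /LminusP [a pL]; have /= eq_f := tandem_fend pL; exists a.
  rewrite !inE eq_f eqxx andbT; apply/mapP; by exists (a, c).
have [_ _ /= ne_ca] := tandemL pL; rewrite eq_f => eqC.
have := congr1 (fun u : vec E => u c) eqC.
rewrite /= !vaddE !chiE !inE eqxx (negbTE ne_ca) restrE ?at_fend // addn0.
by rewrite addn1 => <-.
Qed.

(** Every edge of [L+] is interesting for its firm, while an edge of [L-] is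
    rejected when its associated edge is increased and so is not. *)
Lemma Lplus_Lminus_disjoint : [disjoint Lplus L & Lminus L].
Proof.
rewrite disjoint_subset; apply/subsetP => e eP; rewrite !inE.
apply/negP => eM; have eM' : e \in Lminus L by rewrite inE.
have [a pL] := LminusP eM'; have /= eq_f := tandem_fend pL.
have [aW /= cf ne_ca eqC] := tandemL pL.
have := W_admissible_interesting (Lplus_admissible eP).
rewrite -eq_f; apply: (@CF_rejected_not_interesting _ _ a) => //.
- exact: at_fend.
- by rewrite restrE ?at_fend // W_admissible_cap.
Qed.

(** At a firm the two edges of a tandem are paired up.  At a worker, the ends
    of the entering edges and the ends of the leaving edges are the same cyclic
    sequence, shifted by one place. *)
Lemma rotation_balanced v :
  #|Lplus L :&: edges_at M v| = #|Lminus L :&: edges_at M v|.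
Proof.
have card_setI (r : seq E) (A : {set E}) : uniq r ->
    #|[set e in r] :&: A| = count (mem A) r.
  move=> /(filter_uniq (mem A)) /card_uniqP; rewrite size_filter => <-.
  by apply: eq_card => e; rewrite !inE mem_filter andbC.
rewrite !card_setI //; case: v => [w|f].
  have count_w (r : seq E) : count (mem (edges_at M (inl w))) r =
      count_mem w (map (wend M) r).
    by rewrite count_map; apply: eq_count => e; rewrite /= inE.
  rewrite !count_w -!map_comp; suff /seq.permP/(_ (pred1 w)) :
    perm_eq (map (wend M \o fst) L) (map (wend M \o snd) L) by [].
  case: L cycleL => //= p r.
  have path_map q t : path (fun p p' => wend M p.2 == wend M p'.1) q t ->
      map (wend M \o fst) t = map (wend M \o snd) (belast q t).
    by elim: t q => //= q' t IH q /andP [/eqP -> /IH ->].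
  move=> /path_map; rewrite belast_rcons /= => <-.
  by rewrite map_rcons perm_sym perm_rcons.
rewrite !count_map; apply: eq_in_count => p pL /=.
by rewrite !inE tandem_fend.
Qed.

Let restr_x'E v : (restr M v x' + chi (Lminus L :&: edges_at M v) =
  restr M v x + chi (Lplus L :&: edges_at M v))%R.
Proof.
apply/ffunP => e.
rewrite !vaddE !chiE !ffunE !(in_setI _ (Lplus L)) !(in_setI _ (Lminus L)).
by case: (e \in edges_at M v); rewrite ?andbF ?andbT.
Qed.

Lemma vsize_shift v : vsize (restr M v x') = vsize (restr M v x).
Proof.
have := congr1 vsize (restr_x'E v); rewrite !vsizeD !vsize_chi.
by rewrite rotation_balanced => /addIn.
Qed.

Lemma shift_inB : inB M x'.
Proof.
move=> e; have [[xcap _] _] := hx; move: (x'E e) (xcap e).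
have [/Lplus_admissible/W_admissible_cap|_] := boolP (e \in Lplus L).
  by rewrite /=; lia.
by rewrite /=; lia.
Qed.

Let x'B v : inBv M v (restr M v x').
Proof. exact/restr_inBv/shift_inB. Qed.

(** This single equation yields both that [x'] is acceptable for [f] and that
    [f] prefers [x'] to [x]: the join is [x_f] increased on all edges of [L+]
    at [f], and the associated edges are exactly those rejected from it. *)
Lemma CF_shift f : CF M f (vjoin (restr M (inr f) x') (restr M (inr f) x)) =
  restr M (inr f) x'.
Proof.
set A := Lplus L :&: edges_at M (inr f).
have -> : vjoin (restr M (inr f) x') (restr M (inr f) x) =
    (restr M (inr f) x + chi A)%R.
  apply/ffunP => e; have := x'E e.
  have := @disjointFr _ _ _ e Lplus_Lminus_disjoint.
  rewrite vjoinE vaddE chiE !ffunE in_setI.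
  case: (e \in edges_at M (inr f)); rewrite ?andbF // andbT.
  by case: (e \in Lplus L) => [-> //|_] /=; lia.
apply: (CF_simultaneous_exchange (B := Lminus L :&: edges_at M (inr f))) => //.
- by have [[_ /(_ (inr f)) []]] := hx.
- exact: subsetIr.
- move=> a /setIP [/Lplus_admissible/W_admissible_cap lt_a af].
  by rewrite restrE.
- move=> c /setIP [/Lminus_rejected [a aA lt_C]]; rewrite inE => /eqP eq_f.
  by exists a; rewrite /A -eq_f // restrE ?at_fend.
- by apply: disjointW Lplus_Lminus_disjoint; apply: subsetIl.
- exact: rotation_balanced.
Qed.

Lemma shift_firm_acceptable f : acceptable M (inr f) (restr M (inr f) x').
Proof.
split=> //=; set y := restr M (inr f) x'.
have tB : inBv M (inr f) (vjoin y (restr M (inr f) x)) by exact: inBv_join.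
rewrite -[RHS](CF_shift f); apply: (CF_consistent hM tB) => //.
  by apply/forallP => e; rewrite vjoinE leq_maxl.
by rewrite CF_shift; apply/forallP.
Qed.

Lemma shift_untouched v : Lplus L :&: edges_at M v = set0 ->
  restr M v x' = restr M v x.
Proof.
move=> A0; have B0 : Lminus L :&: edges_at M v = set0.
  by apply/eqP; rewrite -cards_eq0 -rotation_balanced A0 cards0.
apply/ffunP => e; have := congr1 (fun u : vec E => u e) (restr_x'E v).
by rewrite /= A0 B0 !vaddE !chiE in_set0 !addn0.
Qed.

Lemma shift_allocation : g_allocation M x'.
Proof.
split=> [|[w|f]]; [exact: shift_inB| |exact: shift_firm_acceptable].
have [A0|[a]] := set_0Vmem (Lplus L :&: edges_at M (inl w)).
  by rewrite shift_untouched //; case: hx => -[].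
rewrite !inE => /andP [aL /eqP aw]; split=> //=.
have [full _] : W_admissible M x a by apply: Lplus_admissible; rewrite inE.
by rewrite /CW vsize_shift -aw full leqnn.
Qed.

(** A blocking edge [e] of [x'] would be a candidate for the choice of the
    [W]-admissible edge at its worker, which is then weakly preferred to [e] as
    are all edges used by [x]; so [e] could not displace any edge used by
    [x']. *)
Lemma shift_stable : stable M x'.
Proof.
split=> [|e [int_w int_f]]; first exact: shift_allocation.
set w := wend M e in int_w; set f := fend M e in int_f.
have int_fx : interesting_under M (inr f) x e.
  by apply: interesting_firm_antimono int_f; rewrite ?CF_shift.
have not_wx : ~ interesting_under M (inl w) x e.
  by move=> int_wx; case: hx => _ /(_ e); apply.
have [A0|[a0 /setIP [a0L]]] := set_0Vmem (Lplus L :&: edges_at M (inl w)).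
  by apply: not_wx; rewrite /interesting_under -shift_untouched.
rewrite inE => /eqP a0w; have ew : e \in edges_at M (inl w) := at_wend e.
have full : vsize (restr M (inl w) x) = quota M w.
  by have [] := Lplus_admissible a0L; rewrite a0w.
have cap_e : x e < cap M e.
  have /(interesting_firmP _ (xB _)) [ef] := int_fx.
  by rewrite restrE.
(* Otherwise e would block x. *)
have no_worse d : d \in edges_at M (inl w) -> x d != 0 -> ~ pref M w e d.
  move=> dw xd p_ed; apply: not_wx.
  by apply/interesting_workerP => //; split; rewrite ?restrE //;
    exists d; rewrite restrE.
have below a : a \in Lplus L -> wend M a = w -> e = a \/ pref M w a e.
  move=> /Lplus_admissible [_ [l [[]]]] lw xl _ _ best aw.
  rewrite aw in lw best; apply: best; split=> //.
  have [->|ne_el] := eqVneq e l; [by left|right].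
  case/orP: (pref_total hM ew lw ne_el) => // p_el.
  by case: (no_worse l).
have size_x' : vsize (restr M (inl w) x') = quota M w by rewrite vsize_shift.
have /(interesting_workerP _ (x'B _) size_x') [_ _ [d [dw]]] := int_w.
rewrite restrE // => x'd p_ed; have [dL|dNL] := boolP (d \in Lplus L).
  have dw' : wend M d = w by move: dw; rewrite inE => /eqP.
  have := pref_irr hM ew; have [eq_ed|p_de] := below d dL dw'.
    by rewrite -eq_ed in p_ed; rewrite p_ed.
  by rewrite (pref_trans hM dw ew ew p_ed p_de).
apply: (no_worse d) => //; move: (x'E d) x'd; rewrite (negbTE dNL); lia.
Qed.

Lemma shift_precF : L <> [::] -> precF M x x'.
Proof.
move=> L_neq0; split; [by case: hx|exact: shift_allocation| |].
  move=> eq_x; case: L L_neq0 x'E Lplus_Lminus_disjoint => // p r _ x'E' dis.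
  have pP : p.1 \in Lplus (p :: r) by rewrite !inE eqxx.
  by have := x'E' p.1; rewrite -eq_x pP (disjointFr dis pP); lia.
move=> f; have [eq_f|ne_f] := eqVneq (restr M (inr f) x) (restr M (inr f) x').
  by left; split=> //; apply: shift_firm_acceptable.
right; split.
- by case: hx => -[].
- exact: shift_firm_acceptable.
- exact/eqP.
- exact: CF_shift.
Qed.

End Shift.

End Market.

Theorem proposition3p2 (W F E : finType) (M : market W F E)
  (hM : valid_market M) (x : {ffun E -> nat}) (L : seq (E * E))
  (hx : stable M x) (hmax : ~ is_xmax M x) (hL : rotation M x L) :
  exists x' : {ffun E -> nat},
    [/\ vecZ x' = (vecZ x + vecZ (chi (Lplus L)) - vecZ (chi (Lminus L)))%R,
        stable M x' & precF M x x'].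
Proof.
have [G _ [L_neq0 inG cycleL uniqLp uniqLm]] := hL.
have tandemL p : p \in L -> tandem M x p.1 p.2 by move=> /inG [].
pose x' : vec E := [ffun e => x e + (e \in Lplus L) - (e \in Lminus L)].
have x'E e : x' e + (e \in Lminus L) = x e + (e \in Lplus L).
  rewrite ffunE subnK //; case: (boolP (e \in Lminus L)) => // eL.
  by have [a _ lt_C] := Lminus_rejected tandemL eL; rewrite /=; lia.
exists x'; split.
- apply/ffunP => e; have := x'E e; move: (x' e) => n.
  by rewrite !ffunE; lia.
- exact: (shift_stable hM hx tandemL cycleL uniqLp uniqLm x'E).
- exact: (shift_precF hM hx tandemL cycleL uniqLp uniqLm x'E L_neq0).
Qed.
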